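(* Let $n\ge 1$ and let $G$ be a self-complementary graph on $n$ vertices. Then $G$ contains the complete graph $K_{\lfloor \frac{n+1}{2}\rfloor}$ as a minor.
   Context: All graphs are finite, simple (no loops, no multiple edges) and undirected. The complement $cG$ of a graph $G$ on $n$ vertices has the same vertex set, with $uv$ an edge of $cG$ iff $u\ne v$ and $uv$ is not an edge of $G$. $G$ is self-complementary if it is isomorphic to $cG$. A minor of $G$ is any graph obtained from $G$ by a sequence of edge deletions, vertex deletions and edge contractions (contracting an edge identifies its endpoints and removes resulting loops and multiple edges). *)

(* Defs.v *)
From mathcomp Require Import all_boot.

Set Implicit Arguments.
Unset Strict Implicit.
Unset Printing Implicit Defensive.

Record sgraph := SGraph {
  vertex :> finType;
  adj : rel vertex;
  adj_sym : symmetric adj;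
  adj_irrefl : irreflexive adj
}.

Definition isomorphic (G H : sgraph) : Prop :=
  exists2 f : G -> H, bijective f & forall x y, adj (f x) (f y) = adj x y.

Section Complement.
Variable G : sgraph.

Definition compl_rel : rel G := fun x y => (x != y) && ~~ adj x y.

Lemma compl_rel_sym : symmetric compl_rel.
Proof. by move=> x y; rewrite /compl_rel eq_sym adj_sym. Qed.

Lemma compl_rel_irrefl : irreflexive compl_rel.
Proof. by move=> x; rewrite /compl_rel eqxx. Qed.

Definition compl : sgraph := SGraph compl_rel_sym compl_rel_irrefl.

End Complement.

Definition self_complementary (G : sgraph) : Prop := isomorphic G (compl G).

Section Complete.
Variable m : nat.

Definition complete_rel : rel 'I_m := fun x y => x != y.

Lemma complete_rel_sym : symmetric complete_rel.
Proof. by move=> x y; rewrite /complete_rel eq_sym. Qed.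

Lemma complete_rel_irrefl : irreflexive complete_rel.
Proof. by move=> x; rewrite /complete_rel eqxx. Qed.

Definition complete : sgraph := SGraph complete_rel_sym complete_rel_irrefl.

End Complete.

Section EdgeDeletion.
Variables (G : sgraph) (u v : G).

Definition del_edge_rel : rel G := fun x y =>
  adj x y && ~~ (((x == u) && (y == v)) || ((x == v) && (y == u))).

Lemma del_edge_rel_sym : symmetric del_edge_rel.
Proof.
move=> x y; rewrite /del_edge_rel adj_sym orbC.
by rewrite (andbC (x == v)) (andbC (x == u)).
Qed.

Lemma del_edge_rel_irrefl : irreflexive del_edge_rel.
Proof. by move=> x; rewrite /del_edge_rel adj_irrefl. Qed.

Definition del_edge : sgraph := SGraph del_edge_rel_sym del_edge_rel_irrefl.

End EdgeDeletion.

Section VertexDeletion.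
Variables (G : sgraph) (v : G).

Definition del_vertex_rel : rel {x : G | x != v} :=
  fun x y => adj (val x) (val y).

Lemma del_vertex_rel_sym : symmetric del_vertex_rel.
Proof. by move=> x y; rewrite /del_vertex_rel adj_sym. Qed.

Lemma del_vertex_rel_irrefl : irreflexive del_vertex_rel.
Proof. by move=> x; rewrite /del_vertex_rel adj_irrefl. Qed.

Definition del_vertex : sgraph :=
  SGraph del_vertex_rel_sym del_vertex_rel_irrefl.

End VertexDeletion.

(* The vertex obtained by identifying u and v is represented by u, so the    *)
(* contracted graph lives on the vertices other than v.                      *)
Section Contraction.
Variables (G : sgraph) (u v : G).

Definition merge (x : G) : G := if x == v then u else x.

Definition contract_rel : rel {x : G | x != v} := fun x y =>
  (x != y) &&
  [exists a : G, exists b : G,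
     [&& adj a b, merge a == val x & merge b == val y]].

Lemma contract_rel_sym : symmetric contract_rel.
Proof.
move=> x y; rewrite /contract_rel eq_sym; congr (_ && _).
by apply/existsP/existsP => -[a /existsP[b /and3P[ab ax By]]];
   exists b; apply/existsP; exists a; rewrite adj_sym ab ax By.
Qed.

Lemma contract_rel_irrefl : irreflexive contract_rel.
Proof. by move=> x; rewrite /contract_rel eqxx. Qed.

Definition contract : sgraph := SGraph contract_rel_sym contract_rel_irrefl.

End Contraction.

Inductive minor_step (G : sgraph) : sgraph -> Prop :=
| StepDelEdge (u v : G) : adj u v -> minor_step G (del_edge u v)
| StepDelVertex (v : G) : minor_step G (del_vertex v)
| StepContract (u v : G) : adj u v -> minor_step G (contract u v).

(* Graphs are compared up to isomorphism at the end of the sequence. *)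
Inductive has_minor (G H : sgraph) : Prop :=
| MinorIso : isomorphic G H -> has_minor G H
| MinorStep (G' : sgraph) : minor_step G G' -> has_minor G' H -> has_minor G H.

(* Main.v *)
Require Import Defs.
From mathcomp Require Import all_boot perm zify.

(** Let [s] be an isomorphism from [G] to its complement, read as a permutation
    of the vertices. For distinct [x], [y] exactly one of [xy], [(s x)(s y)] is
    an edge. Hence any two disjoint pairs [{x, s x}], [{y, s y}] are joined by
    an edge, [s] has at most one fixed point, and along every nontrivial cycle
    of [s] the pairs [{x, s x}] are alternately edges and non-edges. The pairs
    that are edges thus partition the non-fixed vertices, and contracting them
    yields a complete graph on [ceil (n / 2)] vertices. *)

Set Implicit Arguments.
Unset Strict Implicit.
Unset Printing Implicit Defensive.

Lemma homo_connect (T T' : finType) (e : rel T) (e' : rel T') (h : T -> T') :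
  {homo h : x y / e x y >-> connect e' x y} ->
  {homo h : x y / connect e x y >-> connect e' x y}.
Proof.
move=> h_homo x y /connectP[p]; elim: p x => [|z p IHp] x /=.
  by move=> _ ->; apply: connect0.
by case/andP=> /h_homo/connect_trans xz /IHp zy /zy; apply: xz.
Qed.

Record quotient_map (G H : sgraph) (f : G -> H) : Prop := QuotientMap {
  quotient_map_surj : forall a, exists x, f x = a;
  quotient_map_adj : forall a b, adj a b <->
    a != b /\ exists x y, [/\ f x = a, f y = b & adj x y]
}.

Definition fiber_adj (G : sgraph) (T : eqType) (f : G -> T) : rel G :=
  [rel x y | (f x == f y) && adj x y].

Definition connected_fibers (G : sgraph) (T : eqType) (f : G -> T) : Prop :=
  forall x y, f x = f y -> connect (fiber_adj f) x y.

Lemma quotient_map_inj_isomorphic (G H : sgraph) (f : G -> H) :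
  quotient_map f -> injective f -> isomorphic G H.
Proof.
case=> f_surj f_adj f_inj; exists f.
  apply: inj_card_bij => //; rewrite -(card_codom f_inj).
  apply/subset_leq_card/subsetP => a _.
  by have [x <-] := f_surj a; apply: codom_f.
move=> x y; apply/idP/idP => [/f_adj[_ [x' [y' [/f_inj-> /f_inj-> //]]]] | xy].
apply/f_adj; split; last by exists x, y.
by apply: contraTneq xy => /f_inj->; rewrite adj_irrefl.
Qed.

Lemma connected_fibers_adj (G : sgraph) (T : eqType) (f : G -> T) :
  connected_fibers f -> ~~ injectiveb f -> exists u v, f u = f v /\ adj u v.
Proof.
move=> f_conn /injectivePn[u [w neq_uw /f_conn/connectP[[|v p] /=]]].
  by move=> _ eq_wu; rewrite eq_wu eqxx in neq_uw.
by case/andP=> /andP[/eqP fuv uv] _ _; exists u, v.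
Qed.

Section QuotientFactor.

Variables (G K : sgraph) (p : G -> K).
Hypothesis p_quot : quotient_map p.

Lemma quotient_map_factor (H : sgraph) (f : G -> H) (g : K -> H) :
  f =1 g \o p -> quotient_map f -> quotient_map g.
Proof.
move=> fE [f_surj f_adj]; split=> [a | a b].
  by have [x <-] := f_surj a; exists (p x); rewrite fE.
split=> [/f_adj[neq_ab [x [y [fx fy xy]]]] | [neq_ab [c [d [gc gd cd]]]]].
  have gpx : g (p x) = a by rewrite -fx fE.
  have gpy : g (p y) = b by rewrite -fy fE.
  split=> //; exists (p x), (p y); split=> //.
  apply/(quotient_map_adj p_quot); split; last by exists x, y.
  by apply: contraNneq neq_ab => pxy; rewrite -gpx -gpy pxy.
have [_ [x [y [px py xy]]]] := (quotient_map_adj p_quot c d).1 cd.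
by apply/f_adj; split=> //; exists x, y; rewrite !fE /= px py.
Qed.

Lemma connected_fibers_factor (T : eqType) (f : G -> T) (g : K -> T) :
  f =1 g \o p -> connected_fibers f -> connected_fibers g.
Proof.
move=> fE f_conn c d.
have [x <-] := quotient_map_surj p_quot c.
have [y <-] := quotient_map_surj p_quot d.
have fpE z : g (p z) = f z by rewrite fE.
rewrite !fpE => /f_conn; apply: homo_connect => {}x {}y /andP[/eqP fxy xy].
have [-> // | neq_pxy] := eqVneq (p x) (p y).
apply: connect1; rewrite /fiber_adj /= !fpE fxy eqxx.
by apply/(quotient_map_adj p_quot); split=> //; exists x, y.
Qed.

End QuotientFactor.

Section ContractProjection.

Variables (G : sgraph) (u v : G).
Hypothesis neq_uv : u != v.

Lemma merge_neq x : Defs.merge u v x != v.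
Proof. by rewrite /Defs.merge; case: ifPn. Qed.

Definition contract_proj (x : G) : contract u v :=
  exist _ (Defs.merge u v x) (merge_neq x).

Lemma contract_proj_val (a : contract u v) : contract_proj (val a) = a.
Proof. by apply: val_inj; rewrite /= /Defs.merge (negPf (valP a)). Qed.

Lemma contract_proj_factor (T : Type) (f : G -> T) :
  f u = f v -> f =1 (f \o val : contract u v -> T) \o contract_proj.
Proof. by move=> fuv x; rewrite /= /Defs.merge; case: eqP => // ->. Qed.

Lemma contract_proj_quotient_map : quotient_map contract_proj.
Proof.
split=> [a | a b]; first by exists (val a); apply: contract_proj_val.
split=> [/andP[neq_ab /existsP[x /existsP[y /and3P[xy /eqP xa /eqP yb]]]] |].
  by split=> //; exists x, y; split=> //; apply: val_inj.
case=> neq_ab [x [y [xa yb xy]]]; apply/andP; split=> //.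
by apply/existsP; exists x; apply/existsP; exists y; rewrite -xa -yb xy !eqxx.
Qed.

Lemma card_contract : #|contract u v| < #|G|.
Proof. by rewrite card_sig cardC1 ltn_predL; apply/card_gt0P; exists v. Qed.

End ContractProjection.

Lemma has_minor_quotient (G H : sgraph) (f : G -> H) :
  quotient_map f -> connected_fibers f -> has_minor G H.
Proof.
have [k] := ubnP #|G|; elim: k => // k IHk in G f * => ltGk f_quot f_conn.
have [/injectiveP f_inj | f_ninj] := boolP (injectiveb f).
  by apply: MinorIso; apply: quotient_map_inj_isomorphic f_inj.
have [u [v [fuv uv]]] := connected_fibers_adj f_conn f_ninj.
have neq_uv : u != v by apply: contraTneq uv => ->; rewrite adj_irrefl.
have proj_quot := contract_proj_quotient_map neq_uv.
have fE := contract_proj_factor neq_uv fuv.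
have val_quot := quotient_map_factor proj_quot fE f_quot.
have val_conn := connected_fibers_factor proj_quot fE f_conn.
apply: MinorStep (StepContract uv) (IHk _ _ _ val_quot val_conn).
exact: leq_trans (card_contract u v) ltGk.
Qed.

Lemma has_minor_complete (G : sgraph) (T : finType) (f : G -> T) :
    connected_fibers f ->
    {in codom f &, forall a b, a != b ->
      exists x y, [/\ f x = a, f y = b & adj x y]} ->
  has_minor G (complete #|codom f|).
Proof.
move=> f_conn f_adj.
pose r x : complete #|codom f| := enum_rank_in (codom_f f x) (f x).
have rK x : enum_val (r x) = f x by apply: enum_rankK_in (codom_f f x).
have rP x a : f x = enum_val a -> r x = a.
  by move=> fx; apply: enum_val_inj; rewrite rK.
apply: (@has_minor_quotient _ _ r); first split=> [a | a b].
- by have /codomP[x fx] := enum_valP a; exists x; apply: rP.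
- split=> [neq_ab | [//]]; split=> //.
  have neq_val : enum_val a != enum_val b by rewrite (inj_eq enum_val_inj).
  have [x [y [fx fy xy]]] := f_adj _ _ (enum_valP a) (enum_valP b) neq_val.
  by exists x, y; rewrite (rP x a) ?(rP y b).
- have r_fiber : fiber_adj r =2 fiber_adj f.
    by move=> x y; rewrite /fiber_adj /= -!rK (inj_eq enum_val_inj).
  move=> x y /(congr1 enum_val); rewrite !rK (eq_connect r_fiber).
  exact: f_conn.
Qed.

Definition antimorphism (G : sgraph) (s : {perm G}) : Prop :=
  forall x y, x != y -> adj (s x) (s y) = ~~ adj x y.

Lemma self_complementary_antimorphism (G : sgraph) :
  self_complementary G -> exists s : {perm G}, antimorphism s.
Proof.
case=> f /bij_inj f_inj f_compl; exists (perm f_inj) => x y neq_xy.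
by rewrite !permE -(f_compl x y) /= /compl_rel (inj_eq f_inj) neq_xy negbK.
Qed.

Section Antimorphism.

Variables (G : sgraph) (s : {perm G}).
Hypothesis s_anti : antimorphism s.

(* Each edge joining [x] to [s x] is oriented from [x] to [s x]; [tail] sends
   both of its ends to [x]. A fixed point of [s] counts as its own tail. *)
Definition tails : {set G} := [set x | (s x == x) || adj x (s x)].

Definition tail (x : G) : G := if x \in tails then x else (s^-1)%g x.

Lemma card_antimorphism_fixed : #|[set x | s x == x]| <= 1.
Proof.
apply/card_le1_eqP => x y; rewrite !inE => /eqP sx /eqP sy.
by have [// | /s_anti] := eqVneq x y; rewrite sx sy; case: adj.
Qed.

Lemma mem_tails_antimorphism x : s x != x -> (s x \in tails) = (x \notin tails).
Proof.
by move=> sx; rewrite !inE (inj_eq perm_inj) (negPf sx) /= s_anti // eq_sym.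
Qed.

Lemma mem_tail x : tail x \in tails.
Proof.
rewrite /tail; case: ifPn => // xS.
have sVx : s ((s^-1)%g x) = x by apply: permKV.
apply: contraNT xS => sVxS; rewrite -sVx mem_tails_antimorphism //.
by apply: contraNneq sVxS => fix_sVx; rewrite inE fix_sVx eqxx.
Qed.

Lemma tail_id : {in tails, tail =1 id}.
Proof. by rewrite /tail => x ->. Qed.

Lemma tail_antimorphism : {in tails, cancel s tail}.
Proof.
move=> x xS; have [sx | sx] := eqVneq (s x) x; first by rewrite sx tail_id.
by rewrite /tail mem_tails_antimorphism // xS permK.
Qed.

Lemma tail_cases x : x = tail x \/ x = s (tail x).
Proof. by rewrite /tail; case: ifP; [left | right; rewrite permKV]. Qed.

Lemma codom_tail : codom tail =i tails.
Proof.
move=> x; apply/codomP/idP => [[y ->] | xS]; first exact: mem_tail.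
by exists x; rewrite tail_id.
Qed.

Lemma connected_fibers_tail : connected_fibers tail.
Proof.
move=> x y txy; have [-> // | neq_xy] := eqVneq x y.
apply: connect1; rewrite /fiber_adj /= txy eqxx /=.
move: (tail_cases x) (tail_cases y) (mem_tail y) neq_xy.
rewrite txy inE; move: (tail y) => z.
by move=> [] -> [] -> /orP[/eqP | ] zS; rewrite ?zS ?eqxx // adj_sym zS.
Qed.

Lemma tail_fibers_adj a b : a \in tails -> b \in tails -> a != b ->
  exists x y, [/\ tail x = a, tail y = b & adj x y].
Proof.
move=> aS bS neq_ab; have [ab | nab] := boolP (adj a b).
  by exists a, b; rewrite !tail_id.
by exists (s a), (s b); rewrite !tail_antimorphism // s_anti.
Qed.

Lemma tailsU_imset : tails :|: s @: tails = setT.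
Proof.
apply/setP => x; rewrite in_setU in_setT; have xS := mem_tail x.
have [-> | ->] := tail_cases x; first by rewrite xS.
by rewrite imset_f ?orbT.
Qed.

Lemma tailsI_imset : tails :&: s @: tails = [set x | s x == x].
Proof.
apply/setP => x; rewrite [RHS]inE in_setI; apply/andP/eqP => [[xS] | sx].
  case/imsetP=> y yS xE; apply/eqP; rewrite xE (inj_eq perm_inj).
  by apply: contraTT xS => /mem_tails_antimorphism; rewrite -xE yS => ->.
have xS : x \in tails by rewrite inE sx eqxx.
by split=> //; rewrite -sx imset_f.
Qed.

Lemma card_tails : #|tails| = uphalf #|G|.
Proof.
have := cardsUI tails (s @: tails); have := card_antimorphism_fixed.
rewrite tailsU_imset tailsI_imset cardsT card_imset; last exact: perm_inj.
lia.
Qed.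

End Antimorphism.

Theorem theorem1 (n : nat) (hn : 1 <= n) (G : sgraph) (hG : #|G| = n)
    (hsc : self_complementary G) :
  has_minor G (complete ((n + 1) %/ 2)).
Proof.
have [s s_anti] := self_complementary_antimorphism hsc.
have codom_tails := codom_tail s_anti.
have <- : #|codom (tail s)| = (n + 1) %/ 2.
  by rewrite (eq_card codom_tails) card_tails // hG addn1 divn2.
apply: has_minor_complete; first exact: connected_fibers_tail.
by move=> a b; rewrite !codom_tails; apply: tail_fibers_adj.
Qed.
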